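(* Let $k$ be a non-negative integer and let $D=(V,A)$ be a semicomplete digraph with $\lambda(D)\ge \frac{(k+1)^2}{4}+1$. Then for every set $A'\subseteq A$ of $k$ arcs, $D$ has a spanning eulerian subdigraph containing no arc of $A'$.
   Context: Digraphs are finite, with no loops and no parallel arcs (two opposite arcs are allowed). A digraph is semicomplete if it has no pair of non-adjacent vertices. A digraph is strong if it has an $(s,t)$-path for each ordered pair of distinct vertices $s,t$; it is $k$-arc-strong if it remains strong after deletion of any set of at most $k-1$ arcs. The arc-connectivity $\lambda(D)$ is the largest $k$ such that $D$ is $k$-arc-strong. A digraph is eulerian if it is connected and every vertex has in-degree equal to out-degree; a subdigraph is spanning if it contains all vertices of $D$. *)

(* Defs.v *)
From mathcomp Require Import all_boot all_order all_algebra.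

Set Implicit Arguments.
Unset Strict Implicit.
Unset Printing Implicit Defensive.

Import Order.TTheory GRing.Theory Num.Theory.

(** A digraph on the finite vertex type [V] is given by its set
    of arcs [A : {set V * V}], where [(x, y)] is the arc from [x] to [y]; parallel
    arcs are thus excluded and opposite arcs allowed. A spanning
    subdigraph keeps the vertex type, so it is given by a subset of [A]. *)

Section Digraphs.
Variable V : finType.
Implicit Types (A B : {set V * V}) (k : nat).

Definition loopless A := [forall x, (x, x) \notin A].

Definition semicomplete A :=
  [forall x, forall y, (x != y) ==> ((x, y) \in A) || ((y, x) \in A)].

Definition strong A :=
  [forall s, forall t, (s != t) ==> connect (fun x y => (x, y) \in A) s t].

(** [#|B| < k] is "at most k - 1 arcs"; in particular, every digraph is
    0-arc-strong. *)
Definition arc_strong k A :=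
  [forall B : {set V * V}, (B \subset A) && (#|B| < k) ==> strong (A :\: B)].

(** The largest [k] such that [A] is [k]-arc-strong. With at most one
    vertex there is no largest [k], and [None] stands for infinity. With at
    least two, deleting all the arcs leaves a digraph that is not strong, so
    no [k > #|A|] qualifies; see [arc_strongE]. *)
Definition arc_connectivity A : option nat :=
  if 1 < #|V| then Some (\max_(k < #|A|.+1 | arc_strong k A) k) else None.

(** Connectedness of the underlying undirected graph. *)
Definition connected A :=
  [forall s, forall t,
     connect (fun x y => ((x, y) \in A) || ((y, x) \in A)) s t].

Definition indeg A x := #|[set y | (y, x) \in A]|.
Definition outdeg A x := #|[set y | (x, y) \in A]|.

Definition eulerian A := connected A && [forall x, indeg A x == outdeg A x].

(** [B] is the arc set of a subdigraph with vertex set [V]. *)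
Definition spanning_eulerian_subdigraph B A := (B \subset A) && eulerian B.

End Digraphs.

(** [q <= l], where [l = None] is infinity. *)
Definition le_ext (q : rat) (l : option nat) : bool :=
  if l is Some n then (q <= n%:R)%R else true.

Lemma arc_strongE (V : finType) (A : {set V * V}) (k : nat) :
  arc_strong k A = le_ext k%:R (arc_connectivity A).
Proof.
rewrite /arc_connectivity; case: ltnP => [V2 | V1] /=; last first.
  apply/forallP=> B; apply/implyP=> _; apply/forallP=> s; apply/forallP=> t.
  by rewrite (fintype_le1P V1 s t) eqxx.
rewrite ler_nat; apply/idP/idP=> [Ak | ].
  have kA : k < #|A|.+1.
    rewrite ltnS leqNgt; apply/negP=> Alt.
    have /implyP := forallP Ak A; rewrite subxx Alt => /(_ isT).
    have /card_gt1P[s [t [_ _ st]]] := V2.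
    move=> /forallP/(_ s)/forallP/(_ t); rewrite st setDv => /connectP[[|y p]] /=.
      by move=> _ ts; rewrite ts eqxx in st.
    by rewrite inE.
  exact: (@leq_bigmax_cond _ (fun i : 'I_#|A|.+1 => arc_strong i A)
           (fun i => i : nat) (Ordinal kA)).
have A0 : 0 < #|[pred i : 'I_#|A|.+1 | arc_strong i A]|.
  by apply/card_gt0P; exists ord0; rewrite inE; apply/forallP=> B; rewrite andbF.
have [j Aj ->] := eq_bigmax_cond (fun i : 'I_#|A|.+1 => i : nat) A0.
move=> kj; apply/forallP=> B; apply/implyP=> /andP[BA Bk].
by have /implyP := forallP Aj B; apply; rewrite BA (leq_trans Bk kj).
Qed.

(* Main.v *)
(* The components of the graph of [A'] have sum of (size - 1) at most k, so deleting
   every arc of D inside a component removes at most (k+1)^2/4 arcs of each cut.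
   What remains, B, is a strong semicomplete multipartite digraph avoiding [A'].
   By Hoffman's theorem, B has a balanced subdigraph covering all vertices unless
   some T, W with union V have fewer than |T :&: W| arcs from T to W; for T :&: W
   minimal this set is independent, hence inside one component, and the component
   is split unevenly enough by T or by the complement of W for the cut to keep
   |T :&: W| arcs.
   Finally take a covering balanced H connecting as many pairs as possible. The
   arcs of B between different components of H contain no cycle, as it could be
   added to H, so some vertex s has no such arc entering it. If such an arc
   enters the component of s at x', another one enters each H-predecessor x of x',
   since otherwise two components could be merged by exchanging arcs; going back
   to s, no such arc enters the component of s, so this component is everything. *)
Require Import Defs.
From mathcomp Require Import all_boot all_order all_algebra.
From mathcomp Require Import zify lra.

Set Implicit Arguments.
Unset Strict Implicit.
Unset Printing Implicit Defensive.

Import Order.TTheory GRing.Theory Num.Theory.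

Local Notation arc B := (fun x y => (x, y) \in B).

(** * Balanced arc sets: cuts, reachability and cycles *)

Section Balanced.
Variable T : finType.
Implicit Types (B Z : {set T * T}) (S : {set T}).

Definition balanced B := [forall x, indeg B x == outdeg B x].

Definition arcs_between B S S' := [set a in B | (a.1 \in S) && (a.2 \in S')].

Lemma outdegE B x : outdeg B x = \sum_y ((x, y) \in B).
Proof.
rewrite /outdeg -sum1_card big_mkcond /=; apply: eq_bigr => y _.
by rewrite inE; case: (_ \in _).
Qed.

Lemma indegE B x : indeg B x = \sum_y ((y, x) \in B).
Proof.
rewrite /indeg -sum1_card big_mkcond /=; apply: eq_bigr => y _.
by rewrite inE; case: (_ \in _).
Qed.

Lemma card_arcs_between B S S' :
  #|arcs_between B S S'| = \sum_(x in S) \sum_(y in S') ((x, y) \in B).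
Proof.
rewrite pair_big /= -sum1_card big_mkcond /= [RHS]big_mkcond /=.
apply: eq_bigr => -[x y] _; rewrite !inE /=.
by case: (_ \in B); case: (x \in S); case: (y \in S').
Qed.

Lemma sum_outdeg B S : \sum_(x in S) outdeg B x = #|arcs_between B S setT|.
Proof.
rewrite card_arcs_between; apply: eq_bigr => x _; rewrite outdegE.
by apply: eq_bigl => y; rewrite inE.
Qed.

Lemma sum_indeg B S : \sum_(x in S) indeg B x = #|arcs_between B setT S|.
Proof.
rewrite card_arcs_between exchange_big; apply: eq_bigr => x _; rewrite indegE.
by apply: eq_bigl => y; rewrite inE.
Qed.

Lemma card_arcs_betweenIr B S S' :
  #|arcs_between B S setT| = #|arcs_between B S S'| + #|arcs_between B S (~: S')|.
Proof.
rewrite -cardsUI [X in _ = _ + X](_ : _ = 0); last first.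
  by apply/eqP; rewrite cards_eq0; apply/eqP/setP=> a; rewrite !inE; do !case: (_ \in _).
by rewrite addn0; apply: eq_card => a; rewrite !inE; do !case: (_ \in _).
Qed.

Lemma card_arcs_betweenIl B S S' :
  #|arcs_between B setT S'| = #|arcs_between B S S'| + #|arcs_between B (~: S) S'|.
Proof.
rewrite -cardsUI [X in _ = _ + X](_ : _ = 0); last first.
  by apply/eqP; rewrite cards_eq0; apply/eqP/setP=> a; rewrite !inE; do !case: (_ \in _).
by rewrite addn0; apply: eq_card => a; rewrite !inE; do !case: (_ \in _).
Qed.

Lemma balanced_cut B S : balanced B ->
  #|arcs_between B S (~: S)| = #|arcs_between B (~: S) S|.
Proof.
move=> /forallP bB; apply: (@addnI #|arcs_between B S S|).
rewrite -card_arcs_betweenIr -card_arcs_betweenIl -sum_outdeg -sum_indeg.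
by apply: eq_bigr => x _; rewrite (eqP (bB x)).
Qed.

Lemma balanced_exit B S u v : balanced B -> (u, v) \in B ->
  u \notin S -> v \in S -> exists a, [/\ a \in B, a.1 \in S & a.2 \notin S].
Proof.
move=> bB uvB uS vS.
have: 0 < #|arcs_between B S (~: S)|.
  by rewrite balanced_cut //; apply/card_gt0P; exists (u, v); rewrite !inE uvB uS vS.
case/card_gt0P=> a; rewrite !inE => /andP[aB /andP[a1 a2]].
by exists a.
Qed.

Lemma connect_enter (e : rel T) S x y : connect e x y -> x \notin S -> y \in S ->
  exists u v, [/\ e u v, u \notin S & v \in S].
Proof.
case/connectP=> p; elim: p x => [|z p IHp] x /=; first by move=> _ -> /negP.
case/andP=> exz pz py xS yS; case: (boolP (z \in S)) => zS; first by exists x, z.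
exact: IHp pz py zS yS.
Qed.

(** No arc leaves the set reachable from [y], so by balance none enters it; a path from [x] into
    this set must therefore start inside it. *)
Lemma balanced_connectC B x y : balanced B ->
  connect (arc B) x y -> connect (arc B) y x.
Proof.
move=> bB xy; set S := [set z | connect (arc B) y z].
case: (boolP (x \in S)) => [|xS]; first by rewrite inE.
have yS : y \in S by rewrite inE.
have [u [v [uv uS vS]]] := connect_enter xy xS yS.
have [[a1 a2] [/= aB aS]] := balanced_exit bB uv uS vS.
rewrite inE in aS; rewrite inE => /negP[].
exact: connect_trans aS (connect1 aB).
Qed.

Lemma exists_cycle (e : rel T) x y : e x y -> connect e y x ->
  exists Z, [/\ balanced Z, (x, y) \in Z & forall u v, (u, v) \in Z -> e u v].
Proof.
move=> exy /connectP[p0 py0 eqx]; rewrite {}eqx in exy *.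
case/shortenP: py0 exy => p py Up _ exy.
have Cp : cycle e (y :: p) by rewrite /= rcons_path py.
pose Z := [set (u, next (y :: p) u) | u in y :: p].
have inZ u v : ((u, v) \in Z) = (u \in y :: p) && (v == next (y :: p) u).
  apply/imsetP/andP => [[w wp [-> ->]] | [up /eqP->]]; first by rewrite wp eqxx.
  by exists u.
exists Z; split.
- apply/forallP=> u; rewrite /indeg /outdeg.
  have [up | up] := boolP (u \in y :: p).
    rewrite (_ : [set v | (v, u) \in Z] = [set prev (y :: p) u]); last first.
      apply/setP=> v; rewrite !inE inZ; apply/andP/eqP => [[vp /eqP->]|->].
        by rewrite prev_next.
      by rewrite mem_prev next_prev.
    rewrite (_ : [set v | (u, v) \in Z] = [set next (y :: p) u]) ?cards1 //.
    by apply/setP=> v; rewrite !inE inZ up.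
  rewrite (_ : [set v | (v, u) \in Z] = set0); last first.
    apply/setP=> v; rewrite !inE inZ; apply/andP=> -[vp /eqP uv].
    by rewrite uv mem_next vp in up.
  rewrite (_ : [set v | (u, v) \in Z] = set0) //.
  by apply/setP=> v; rewrite !inE inZ (negPf up).
- by rewrite inZ mem_last next_nth mem_last index_last // nth_default /=.
- by move=> u v; rewrite inZ => /andP[up /eqP->]; apply: next_cycle.
Qed.

(** If [s] has the fewest ancestors, an in-neighbour [u] has the same ancestors as [s]; hence [s]
    reaches [u], closing a cycle. *)
Lemma exists_cycle_indeg (e : rel T) (x0 : T) : (forall x, exists y, e y x) ->
  exists Z, [/\ balanced Z, Z != set0 & forall u v, (u, v) \in Z -> e u v].
Proof.
move=> e_in; pose anc x := #|[set z | connect e z x]|.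
have [s _ smin] := arg_minnP anc (erefl (xpredT x0)).
have [u us] := e_in s.
have sub : [set z | connect e z u] \subset [set z | connect e z s].
  by apply/subsetP=> z; rewrite !inE => zu; apply: connect_trans zu (connect1 us).
have su : connect e s u.
  have /eqP eqS: [set z | connect e z u] == [set z | connect e z s].
    by rewrite eqEcard sub; apply: smin.
  have: s \in [set z | connect e z s] by rewrite inE.
  by rewrite -eqS inE.
have [Z [bZ usZ Ze]] := exists_cycle us su.
by exists Z; split=> //; apply/set0Pn; exists (u, s).
Qed.

End Balanced.

(** * Augmentation in the split network, and Hoffman's cut condition *)

Section Flip.
Variables (V : finType) (A H : {set V * V}).
Hypotheses (A_loopless : loopless A) (HA : H \subset A) (bH : balanced H).

(* Residual network of the flow [H] after splitting each vertex [x] into an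
   entry [(false, x)] and an exit [(true, x)]; the reverse of the internal arc
   is available only when [x] stays covered after losing one unit. *)
Definition residual : rel (bool * V) := fun a b =>
  match a, b with
  | (true, u), (false, w) => if u == w then 1 < outdeg H u else (u, w) \in A :\: H
  | (false, w), (true, u) => (u == w) || ((u, w) \in H)
  | _, _ => false
  end.

Variable Z : {set (bool * V) * (bool * V)}.
Hypotheses (bZ : balanced Z) (Zres : forall a b, (a, b) \in Z -> residual a b).

(** The flow [H] augmented along [Z]; the test [a.1 != a.2] keeps internal arcs of the split network
    from becoming loops. *)
Definition flip := [set a : V * V |
  (a \in H) && (((false, a.2), (true, a.1)) \notin Z) ||
  (a.1 != a.2) && (((true, a.1), (false, a.2)) \in Z)].

Lemma loopless_neq u w : (u, w) \in A -> u != w.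
Proof. by apply: contraTneq => ->; apply: (forallP A_loopless). Qed.

Lemma flip_sub : flip \subset A.
Proof.
apply/subsetP=> -[u w]; rewrite inE /= => /orP[/andP[/(subsetP HA)//]|].
by case/andP=> uw /Zres /=; rewrite (negPf uw) inE => /andP[].
Qed.

(** Conservation on a single arc, with subtractions moved across. On the diagonal the [u == w] terms
    cancel the internal arcs. *)
Lemma flipE u w :
  ((u, w) \in flip) + (((false, w), (true, u)) \in Z)
    + (u == w) * (((true, u), (false, u)) \in Z) =
  ((u, w) \in H) + (((true, u), (false, w)) \in Z)
    + (u == w) * (((false, u), (true, u)) \in Z).
Proof.
rewrite inE /=; have [->|uw] := eqVneq u w.
  have /negPf-> : (w, w) \notin H.
    by apply/negP=> /(subsetP HA)/loopless_neq/eqP.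
  by rewrite /= !mul1n addnC.
rewrite /= !mul0n !addn0.
have fwd: ((true, u), (false, w)) \in Z -> (u, w) \notin H.
  by move/Zres; rewrite /= (negPf uw) inE => /andP[].
have bwd: ((false, w), (true, u)) \in Z -> (u, w) \in H.
  by move/Zres; rewrite /= (negPf uw).
case: (boolP (((true, u), (false, w)) \in Z)) fwd => [_ /(_ isT)/negPf-nH|_ _].
  by rewrite nH in bwd *; case: (_ \in Z) bwd => // /(_ isT).
by case: (_ \in Z) bwd => [->//|_]; rewrite andbT orbF !addn0.
Qed.

Lemma sum_bool_pair (f : bool * V -> nat) :
  \sum_a f a = \sum_w f (true, w) + \sum_w f (false, w).
Proof.
rewrite -(big_bool _ (fun b => \sum_w f (b, w))) /= pair_big /=.
by apply: eq_bigr => -[].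
Qed.

Lemma Z_out_true x : outdeg Z (true, x) = \sum_w (((true, x), (false, w)) \in Z).
Proof.
rewrite outdegE sum_bool_pair big1 // => w _.
by case: (boolP (_ \in Z)) => // /Zres.
Qed.

Lemma Z_in_true x : indeg Z (true, x) = \sum_w (((false, w), (true, x)) \in Z).
Proof.
rewrite indegE sum_bool_pair big1 // => w _.
by case: (boolP (_ \in Z)) => // /Zres.
Qed.

Lemma Z_out_false x : outdeg Z (false, x) = \sum_w (((false, x), (true, w)) \in Z).
Proof.
rewrite outdegE sum_bool_pair addnC big1 // => w _.
by case: (boolP (_ \in Z)) => // /Zres.
Qed.

Lemma Z_in_false x : indeg Z (false, x) = \sum_w (((true, w), (false, x)) \in Z).
Proof.
rewrite indegE sum_bool_pair addnC big1 // => w _.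
by case: (boolP (_ \in Z)) => // /Zres.
Qed.

Lemma sum_eq_mul (x : V) (c : V -> nat) : \sum_w (x == w) * c w = c x.
Proof.
rewrite (bigD1 x) //= eqxx mul1n big1 ?addn0 // => w /negPf.
by rewrite eq_sym => ->.
Qed.

(** Summing [flipE] over the heads, the balance of [Z] at the exit of [x] cancels all but the
    internal arcs. *)
Lemma outdeg_flip x :
  outdeg flip x + (((true, x), (false, x)) \in Z) =
  outdeg H x + (((false, x), (true, x)) \in Z).
Proof.
apply: (@addIn (outdeg Z (true, x))).
rewrite -{1}(eqP (forallP bZ _)) Z_in_true Z_out_true !outdegE.
rewrite addnAC [RHS]addnAC.
rewrite -[X in _ + X = _](sum_eq_mul x (fun w => (((true, w), (false, w)) \in Z : nat))).
rewrite -[X in _ = _ + X](sum_eq_mul x (fun w => (((false, w), (true, w)) \in Z : nat))).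
rewrite -!big_split /=; apply: eq_bigr => w _.
have := flipE x w; case: eqVneq => [->|_] //=.
Qed.

Lemma indeg_flip x :
  indeg flip x + (((true, x), (false, x)) \in Z) =
  indeg H x + (((false, x), (true, x)) \in Z).
Proof.
apply: (@addIn (indeg Z (false, x))).
rewrite {1}(eqP (forallP bZ _)) Z_in_false Z_out_false !indegE.
rewrite addnAC [RHS]addnAC.
rewrite -[X in _ + X = _](sum_eq_mul x (fun w => (((true, w), (false, w)) \in Z : nat))).
rewrite -[X in _ = _ + X](sum_eq_mul x (fun w => (((false, w), (true, w)) \in Z : nat))).
rewrite -!big_split /=; apply: eq_bigr => w _.
by have := flipE w x; rewrite eq_sym; case: eqVneq => [->|_].
Qed.

Lemma balanced_flip : balanced flip.
Proof.
apply/forallP=> x; rewrite -(eqn_add2r (((true, x), (false, x)) \in Z)).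
by rewrite indeg_flip outdeg_flip (eqP (forallP bH x)).
Qed.

Lemma outdeg_flip_gt0 x : 0 < outdeg H x -> 0 < outdeg flip x.
Proof.
move=> Hx; have := outdeg_flip x.
case: (boolP (((true, x), (false, x)) \in Z)) => [/Zres|_]; last by lia.
by rewrite /= eqxx; lia.
Qed.

End Flip.

(* Hoffman's circulation theorem with lower bound 1 at every vertex. *)
Lemma eulerian_factor_or_cut (V : finType) (A : {set V * V}) : loopless A ->
  (exists H : {set V * V}, [/\ H \subset A, balanced H & forall x, 0 < outdeg H x]) \/
  (exists T W : {set V}, T :|: W = setT /\ #|arcs_between A T W| < #|T :&: W|).
Proof.
move=> A_loopless.
pose P (H : {set V * V}) := (H \subset A) && balanced H.
have P0 : P set0.
  rewrite /P sub0set; apply/forallP=> x; rewrite /indeg /outdeg.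
  by apply/eqP/eq_card=> y; rewrite !inE.
pose cov (H : {set V * V}) := #|[set x | 0 < outdeg H x]|.
have [H /andP[HA bH] Hmax] := arg_maxnP cov P0.
have [cH | /forallPn[v]] := boolP [forall x, 0 < outdeg H x].
  by left; exists H; split=> //; apply/forallP.
rewrite -eqn0Ngt => /eqP v0.
(* A residual cycle through the internal arc of the uncovered [v] would cover [v] and uncover
   nothing, against the maximality of [H]. *)
have [vv | vv] := boolP (connect (residual A H) (true, v) (false, v)).
  have res_v : residual A H (false, v) (true, v) by rewrite /= eqxx.
  have [Z [bZ vZ Zres]] := exists_cycle res_v vv.
  have PF : P (flip H Z).
    apply/andP; split; first exact: flip_sub Zres.
    exact: (balanced_flip A_loopless HA bH bZ Zres).
  suff: cov H < cov (flip H Z) by rewrite ltnNge; case/negP; apply: Hmax.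
  rewrite /cov; apply: proper_card; apply/properP; split.
    apply/subsetP=> x; rewrite !inE.
    exact: (outdeg_flip_gt0 A_loopless HA bH bZ Zres).
  exists v; rewrite !inE ?v0 //.
  have := outdeg_flip A_loopless HA bZ Zres v; rewrite v0 vZ.
  case: (boolP (((true, v), (false, v)) \in Z)) => [/Zres|_]; last by lia.
  by rewrite /= eqxx v0.
right; pose S := [set a | connect (residual A H) (true, v) a].
have S_closed a b : a \in S -> residual A H a b -> b \in S.
  by rewrite !inE => aS ab; apply: connect_trans aS (connect1 ab).
(* [T] collects the reachable exits, [W] the unreachable entries; internal arcs give the union
   [V]. *)
pose T := [set u | (true, u) \in S]; pose W := [set u | (false, u) \notin S].
have TW u : u \notin T -> u \in W.
  rewrite !inE; apply: contra => uS; have: (true, u) \in S; last by rewrite inE.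
  by apply: (S_closed (false, u)); rewrite ?inE //= eqxx.
exists T, W; split.
  by apply/setP=> u; rewrite !inE; case: (boolP (u \in T)) (TW u) => [|_ /(_ isT)];
    rewrite !inE => ->; rewrite ?orbT.
have vT : v \in T by rewrite !inE.
have vW : v \in W by rewrite !inE.
have -> : arcs_between A T W = arcs_between H T W.
  apply/setP=> -[u w]; rewrite !inE /=; case: (boolP (_ \in H)) => [/(subsetP HA)->//|uwH].
  apply/and3P=> -[uwA uT]; apply/negP; rewrite negbK.
  have: (false, w) \in S; last by rewrite inE.
  apply: (S_closed (true, u)); first by rewrite inE.
  by rewrite /= (negPf (loopless_neq A_loopless uwA)) inE uwH.
have eqC : #|arcs_between H (~: T) W| = #|arcs_between H (~: T) setT|.
  apply: eq_card => -[u w]; rewrite !inE /= andbT; case: (boolP (_ \in H)) => //= uwH.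
  have [//|uT] := boolP (connect _ _ (true, u)); apply/negP=> wS; case/negP: uT.
  have: (true, u) \in S; last by rewrite inE.
  by apply: (S_closed (false, w)); rewrite ?inE //= uwH orbT.
have eqW : \sum_(x in W) outdeg H x =
    \sum_(x in T :&: W) outdeg H x + \sum_(x in ~: T) outdeg H x.
  rewrite (big_setID T) /= setIC; congr (_ + _).
  by apply: eq_bigl => x; rewrite in_setD in_setC; case: (boolP (x \in T)) (TW x) => // _ ->.
have: #|arcs_between H T W| = \sum_(x in T :&: W) outdeg H x.
  apply: (@addIn #|arcs_between H (~: T) W|); rewrite -card_arcs_betweenIl -sum_indeg.
  rewrite eqC -sum_outdeg -eqW; apply: eq_bigr => x _; exact: (eqP (forallP bH x)).
(* On [T :&: W] every out-degree in [H] is at most 1, or the reverse internal arc would reach the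
   entry; at [v] it is 0, whence strictness. *)
move=> ->; rewrite -sum1_card (bigD1 v) ?inE ?vT ?vW //=; last by move: vT vW; rewrite !inE => -> ->.
rewrite [ltnRHS](bigD1 v) /=; last by rewrite in_setI vT vW.
rewrite v0 add0n add1n ltnS; apply: leq_sum => x /andP[]; rewrite in_setI => /andP[xT xW] _.
rewrite leqNgt; apply/negP=> x2; move: xW; rewrite inE => /negP[].
by apply: (S_closed (true, x)); rewrite ?inE //= ?eqxx //; move: xT; rewrite !inE.
Qed.

(** * Merging the components of a covering balanced subdigraph *)

Section Reroute.
Variable V : finType.
Implicit Types (A B H : {set V * V}).

Lemma outdegU1 B u v x : (u, v) \notin B ->
  outdeg ((u, v) |: B) x = (x == u) + outdeg B x.
Proof.
move=> uvB; rewrite !outdegE.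
have -> : (x == u : nat) = \sum_y ((x, y) == (u, v)).
  rewrite (bigD1 v) //= xpair_eqE eqxx andbT big1 ?addn0 // => y /negPf yv.
  by rewrite xpair_eqE yv andbF.
rewrite -big_split; apply: eq_bigr => y _; rewrite !inE.
by case: eqVneq => [-> | _] //; rewrite (negPf uvB).
Qed.

Lemma indegU1 B u v x : (u, v) \notin B ->
  indeg ((u, v) |: B) x = (x == v) + indeg B x.
Proof.
move=> uvB; rewrite !indegE.
have -> : (x == v : nat) = \sum_y ((y, x) == (u, v)).
  rewrite (bigD1 u) //= xpair_eqE eqxx big1 ?addn0 // => y /negPf yv.
  by rewrite xpair_eqE yv.
rewrite -big_split; apply: eq_bigr => y _; rewrite !inE.
by case: eqVneq => [-> | _] //; rewrite (negPf uvB).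
Qed.

Lemma outdegD1 B u v x : (u, v) \in B ->
  outdeg B x = (x == u) + outdeg (B :\ (u, v)) x.
Proof. by move=> uvB; rewrite -{1}(setD1K uvB) outdegU1 // !inE eqxx. Qed.

Lemma indegD1 B u v x : (u, v) \in B ->
  indeg B x = (x == v) + indeg (B :\ (u, v)) x.
Proof. by move=> uvB; rewrite -{1}(setD1K uvB) indegU1 // !inE eqxx. Qed.

Lemma outdegUl B Z x : outdeg B x <= outdeg (B :|: Z) x.
Proof. by apply/subset_leq_card/subsetP=> y; rewrite !inE => ->. Qed.

Lemma balancedU B Z : balanced B -> balanced Z -> [disjoint B & Z] ->
  balanced (B :|: Z).
Proof.
move=> /forallP bB /forallP bZ BZ; apply/forallP=> x.
have inU a : (a \in B :|: Z : nat) = (a \in B) + (a \in Z).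
  rewrite inE; have [aB|//] := boolP (a \in B).
  by rewrite (disjointFr BZ aB).
rewrite indegE outdegE (eq_bigr _ (fun y _ => inU (y, x))).
rewrite [X in _ == X](eq_bigr _ (fun y _ => inU (x, y))) !big_split /=.
by rewrite -!indegE -!outdegE (eqP (bB x)) (eqP (bZ x)).
Qed.

(* An arc [a] missing from [H'] leaves a cut around the part of its [H]-component
   reached from its head, and the balance of [H] forces a second missing arc. *)
Lemma connect_reroute H H' : balanced H -> balanced H' ->
  (forall a b, a \in H :\: H' -> b \in H :\: H' ->
     connect (arc H) a.1 b.1 -> a = b) ->
  forall u v, connect (arc H) u v -> connect (arc H') u v.
Proof.
move=> bH bH' D1; apply: connect_sub => u v uv.
have [uv'|uv'] := boolP ((u, v) \in H'); first exact: connect1.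
pose S := [set z | connect (arc H') v z && connect (arc H) v z].
apply: balanced_connectC => //.
have [|uS] := boolP (u \in S); first by rewrite inE => /andP[].
have vS : v \in S by rewrite inE !connect0.
have [a [aH a1S a2S]] := balanced_exit bH uv uS vS.
have va1 : connect (arc H) v a.1 by move: a1S; rewrite inE => /andP[].
have aa : (a.1, a.2) \in H by rewrite -surjective_pairing.
have aH' : a \notin H'.
  apply: contra a2S => aH'; move: a1S; rewrite !inE => /andP[R'1 R1].
  apply/andP; split; first apply: connect_trans R'1 (connect1 _).
    by rewrite -surjective_pairing.
  exact: connect_trans R1 (connect1 aa).
move: a1S; rewrite -(D1 (u, v) a) ?(negPf uS) ?inE ?uv ?uv' ?aH ?aH' //.
exact: connect_trans (connect1 uv) va1.
Qed.

(** The adjacency hypothesis holds in semicomplete multipartite digraphs: there no vertex shares its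
    class with both ends of an arc. *)
Lemma connected_factor B : strong B ->
    (forall u v x, (u, v) \in B -> x != u -> x != v ->
       [|| (x, u) \in B, (u, x) \in B, (x, v) \in B | (v, x) \in B]) ->
    (exists H, [/\ H \subset B, balanced H & forall x, 0 < outdeg H x]) ->
  exists H, spanning_eulerian_subdigraph H B.
Proof.
move=> /forallP strB multi [H0 [H0B bH0 cH0]].
pose Q (H : {set V * V}) := [&& H \subset B, balanced H & [forall x, 0 < outdeg H x]].
have QH0 : Q H0 by rewrite /Q H0B bH0; apply/forallP.
pose conn (H : {set V * V}) := #|[set p | connect (arc H) p.1 p.2]|.
have [H /and3P[HB bH /forallP cH] Hmax] := arg_maxnP conn QH0.
pose R := connect (arc H).
have RC x y : R x y -> R y x by apply: balanced_connectC.
have RH x y : (x, y) \in H -> R x y by move=> xy; apply: connect1.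
have notH x y : ~~ R x y -> (x, y) \notin H by apply: contra; apply: RH.
(* If [H'] loses at most one arc per component of [H], it keeps all connected pairs by
   [connect_reroute], so by maximality it gains none. *)
have maxH H' u v : Q H' ->
    (forall a b, a \in H :\: H' -> b \in H :\: H' -> R a.1 b.1 -> a = b) ->
  (u, v) \in H' -> R u v.
  move=> QH' D1 uv; have /and3P[_ bH' _] := QH'.
  have RR' := connect_reroute bH bH' D1.
  have sub : [set p | connect (arc H) p.1 p.2] \subset [set p | connect (arc H') p.1 p.2].
    by apply/subsetP=> p; rewrite !inE; apply: RR'.
  have /eqP eqS : [set p | connect (arc H) p.1 p.2] == [set p | connect (arc H') p.1 p.2].
    by rewrite eqEcard sub; apply: Hmax.
  have: (u, v) \in [set p | connect (arc H') p.1 p.2] by rewrite inE; apply: connect1.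
  by rewrite -eqS inE.
suff conH : connected H by exists H; apply/andP; split=> //; apply/andP.
suff sV : V -> exists s, forall x, R s x.
  apply/forallP=> u; apply/forallP=> v.
  have [s Rs] := sV u; apply: connect_sub (connect_trans (RC _ _ (Rs u)) (Rs v)).
  by move=> x y xy; apply: connect1; rewrite xy.
move=> x0.
pose F x y := ((x, y) \in B) && ~~ R x y.
have [s sF] : exists s, forall y, ~~ F y s.
  have [s /forallP sF|nF] := pickP (fun s => [forall y, ~~ F y s]); first by exists s.
  have Fin x : exists y, F y x.
    by have /negbT/forallPn[y] := nF x; rewrite negbK; exists y.
  have [Z [bZ /set0Pn[[u v] uvZ] ZF]] := exists_cycle_indeg x0 Fin.
  have /andP[_ /negP[]] := ZF _ _ uvZ.
  apply: (maxH (H :|: Z)); last by rewrite inE uvZ orbT.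
    apply/and3P; split.
    - rewrite subUset HB; apply/subsetP=> -[a b] /ZF.
      by case/andP.
    - apply: balancedU => //; rewrite disjoint_sym; apply/pred0P=> -[a b] /=.
      by apply/andP=> -[/ZF/andP[_ /notH/negPf->]].
    - by apply/forallP=> x; apply: leq_trans (cH x) (outdegUl _ _ _).
  by move=> a b; rewrite !inE; case: (_ \in H); rewrite ?andbF ?andbT.
(* Either [y'] or an [H]-successor of [y'] will be the tail of an arc of [F] entering [x]. *)
have Fback x x' y' : (x, x') \in H -> F y' x' -> exists y, F y x.
  move=> xx' /andP[yx'B nRyx'].
  have Rxx' := RH _ _ xx'.
  have nRxy' : ~~ R x y' by apply: contra nRyx' => /RC /connect_trans; apply.
  have nRy'x : ~~ R y' x by apply: contra (nRxy'); apply: RC.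
  have [|nF] := boolP (F y' x); first by exists y'.
  (* Otherwise the arc from [x] to [x'] could be replaced by the path through [y'], merging two
     components. *)
  have nxy'B : (x, y') \notin B.
    apply: contra (nRxy') => xy'B.
    pose H1 := H :\ (x, x').
    pose H2 := (x, y') |: H1.
    have n1 : (x, y') \notin H1 by rewrite !inE negb_and (notH _ _ nRxy') orbT.
    have n2 : (y', x') \notin H2.
      rewrite !inE (negPf (notH _ _ nRyx')) andbF orbF xpair_eqE.
      by apply: contraNN nRxy' => /andP[/eqP-> _]; apply: connect0.
    apply: (maxH ((y', x') |: H2)); last by rewrite !inE eqxx orbT.
      apply/and3P; split.
      - rewrite !subUset !sub1set yx'B xy'B.
        by apply: subset_trans HB; apply: subsetDl.
      - apply/forallP=> z; rewrite indegU1 // outdegU1 // indegU1 // outdegU1 //.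
        have := eqP (forallP bH z); rewrite (indegD1 _ xx') (outdegD1 _ xx') => e.
        apply/eqP; move: e; rewrite -/H1; clear; lia.
      - apply/forallP=> z; rewrite outdegU1 // outdegU1 //.
        have := cH z; rewrite (outdegD1 _ xx') -/H1; clear; lia.
    have D a : a \in H :\: ((y', x') |: H2) -> a = (x, x').
      by rewrite !inE; case: (a \in H); rewrite ?andbT ?andbF // !negb_or negbK =>
        /and3P[_ _ /eqP].
    by move=> a b /D-> /D->.
  have nxy'B2 : (y', x) \notin B.
    by apply: contraNN nF => y'xB; rewrite /F y'xB.
  have [y y'y] : exists y, (y', y) \in H.
    by have /card_gt0P[y] := cH y'; rewrite inE; exists y.
  have Ryy' := RH _ _ y'y.
  have nRxy : ~~ R x y by apply: contra (nRxy') => /connect_trans; apply; apply: RC.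
  exists y; apply/andP; split; last by apply: contra nRxy; apply: RC.
  have := multi _ _ x (subsetP HB _ y'y); rewrite (negPf nxy'B) (negPf nxy'B2) /=.
  have -> : x != y' by apply: contraNneq nRxy' => ->; apply: connect0.
  have -> : x != y by apply: contraNneq nRxy => ->; apply: connect0.
  (* As [x] is not adjacent to [y'], it is adjacent to [y]. If the arc goes from [x] to [y],
     exchanging the heads of [(x, x')] and [(y', y)] merges two components, each losing only one
     arc. *)
  move/(_ isT isT)/orP => [xyB|//].
  case/negP: (nRxy).
  pose H1 := H :\ (x, x'); pose H2 := H1 :\ (y', y).
  have y'y1 : (y', y) \in H1.
    rewrite !inE y'y andbT xpair_eqE; apply: contraNN nRxy' => /andP[/eqP-> _].
    exact: connect0.
  pose H3 := (x, y) |: H2.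
  have n1 : (x, y) \notin H2 by rewrite !inE !negb_and (notH _ _ nRxy) !orbT.
  have n2 : (y', x') \notin H3.
    rewrite !inE (negPf (notH _ _ nRyx')) !andbF orbF xpair_eqE.
    by apply: contraNN nRxy' => /andP[/eqP-> _]; apply: connect0.
  apply: (maxH ((y', x') |: H3)); last by rewrite !inE eqxx orbT.
    apply/and3P; split.
    - rewrite !subUset !sub1set yx'B xyB.
      by apply: subset_trans HB; apply: subset_trans (subsetDl _ _) (subsetDl _ _).
    - apply/forallP=> z; rewrite indegU1 // outdegU1 // indegU1 // outdegU1 //.
      have := eqP (forallP bH z); rewrite (indegD1 _ xx') (outdegD1 _ xx').
      rewrite (indegD1 _ y'y1) (outdegD1 _ y'y1) -/H1 -/H2 => e.
      apply/eqP; move: e; clear; lia.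
    - apply/forallP=> z; rewrite outdegU1 // outdegU1 //.
      have := cH z; rewrite (outdegD1 _ xx') (outdegD1 _ y'y1) -/H1 -/H2; clear; lia.
  have D a : a \in H :\: ((y', x') |: H3) -> a = (x, x') \/ a = (y', y).
    rewrite !inE; case: (a \in H); rewrite ?andbT ?andbF // !negb_or negb_and !negbK.
    by case/and3P=> _ _ /orP[/eqP|/eqP]; auto.
  by move=> a b /D[]-> /D[]-> //= r; [case/negP: nRxy' | case/negP: nRy'x].
exists s => w; have [//|sw] := boolP (R s w).
have ws : w != s by apply: contraNneq sw => ->; apply: connect0.
have := forallP (strB w) s; rewrite ws /=.
move/(connect_enter (S := [set z | R s z])); rewrite !inE sw (connect0 _ s : R s s) => /(_ isT isT).
case=> u [v [uvB]]; rewrite !inE => Rsu Rsv.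
have Fuv : F u v.
  by rewrite /F uvB; apply: contra Rsu => /RC; apply: connect_trans.
have [y] : exists y, F y s; last by rewrite (negPf (sF y)).
(* The arc of [F] entering [v] is carried back to [s] along an [H]-path from [s] to [v]. *)
move: Rsv => /connectP[p]; elim: p s {sF sw ws Rsu} => [|z p IHp] s /=.
  by move=> _ <-; exists u.
case/andP=> sz pz vE; have [y Fy] := IHp _ pz vE.
exact: Fback sz Fy.
Qed.

End Reroute.

(** * Arcs lost inside the fibres *)

(** Starting from the identity, each arc relabels the class of its head by that of its tail, which
    costs at most one label. The fibres of [g] stand for the components of [E]. *)
Lemma exists_fibration (V : finType) (E : {set V * V}) :
  exists g : V -> V, (forall a, a \in E -> g a.1 = g a.2) /\
    #|V| <= #|[set g x | x : V]| + #|E|.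
Proof.
have [n] := ubnP #|E|; elim: n E => // n IHn E.
have [->|/set0Pn[a aE]] := eqVneq E set0.
  move=> _; exists id; split=> [a|]; first by rewrite inE.
  by rewrite cards0 addn0 card_imset // cardsT.
rewrite (cardsD1 a) aE ltnS => /IHn[g [gE leV]].
exists (fun x => if g x == g a.2 then g a.1 else g x); split=> [b bE|].
  have [->|ba] := eqVneq b a; first by rewrite eqxx if_same.
  by rewrite gE // !inE ba.
have sub : [set g x | x : V] \subset
    g a.2 |: [set if g x == g a.2 then g a.1 else g x | x : V].
  apply/subsetP=> _ /imsetP[x _ ->]; rewrite !inE; case: eqVneq => //= gx.
  by apply/imsetP; exists x => //; rewrite (negPf gx).
have := subset_leq_card sub; rewrite cardsU1; lia.
Qed.

Section Lost.
Variables (V : finType) (g : V -> V) (k : nat).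
Hypothesis g_rank : #|V| <= #|[set g x | x : V]| + k.
Implicit Types (S : {set V}) (r : V).

Definition fibre r := [set x | g x == r].

Definition same_fibre_pairs S :=
  [set p : V * V | [&& p.1 \in S, p.2 \notin S & g p.1 == g p.2]].

Lemma card_same_fibre_pairs S :
  #|same_fibre_pairs S| = \sum_r #|fibre r :&: S| * #|fibre r :\: S|.
Proof.
rewrite -sum1_card (partition_big (fun p => g p.1) xpredT) //=.
apply: eq_bigr => r _; rewrite -cardsX -sum1_card; apply: eq_bigl => -[x y].
rewrite !inE /=; case: (x \in S) => //=; rewrite ?andbF //.
case: (y \in S) => //=; rewrite ?andbF //.
by rewrite andbC; case: eqVneq => [->|_] //=; rewrite andbT eq_sym.
Qed.

(** Four times the loss allowed to a fibre of [m.+1] vertices. The value 0 at [m = 0], where nothing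
    can be split, makes [cost] superadditive. *)
Definition cost m := if m == 0 then 0 else m.+1 ^ 2.

(** This is [4ab = (a + b)^2 - (a - b)^2] with a difference of at least [y]. For [y = 1] a singleton
    fibre, of cost 0, would be a counterexample. *)
Lemma cost_split a b y : y != 1 -> (a + y <= b) || (b + y <= a) ->
  4 * (a * b) + y ^ 2 <= cost (a + b).-1.
Proof.
move=> y1 hy; rewrite /cost; case: eqVneq => [ab|ab].
  suff [-> ->] : a * b = 0 /\ y = 0 by [].
  nia.
have -> : (a + b).-1.+1 = a + b by lia.
case/orP: hy => hy; rewrite -!mulnn; nia.
Qed.

Lemma costD m n : cost m + cost n <= cost (m + n).
Proof. by case: m n => [|m] [|n]; rewrite /cost //= ?addn0 -?mulnn; nia. Qed.

Lemma cost_sum (n : V -> nat) : \sum_r cost (n r) <= cost (\sum_r n r).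
Proof.
elim/big_rec2: _ => [|r y1 y2 _]; first by rewrite /cost.
by move=> le; apply: leq_trans (leq_add (leqnn _) le) (costD _ _).
Qed.

(** The sum is [#|V|] minus the number of nonempty fibres; empty ones contribute 0 by truncation. *)
Lemma sum_fibre : \sum_r (#|fibre r|.-1) <= k.
Proof.
have eqV : \sum_r #|fibre r| = #|V|.
  rewrite -[RHS]sum1_card [RHS](partition_big g xpredT) //=.
  by apply: eq_bigr => r _; rewrite -sum1_card; apply: eq_bigl => x; rewrite inE.
have : \sum_r (#|fibre r|.-1) + #|[set g x | x : V]| = \sum_r #|fibre r|.
  have -> : #|[set g x | x : V]| = \sum_r (r \in [set g x | x : V]).
    by rewrite -sum1_card big_mkcond; apply: eq_bigr => r _; case: (r \in _).
  rewrite -big_split /=; apply: eq_bigr => r _; case: (boolP (r \in _)) => [/imsetP[x _ ->]|rV].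
    by rewrite addn1 prednK //; apply/card_gt0P; exists x; rewrite inE.
  suff -> : fibre r = set0 by rewrite cards0.
  apply/setP=> x; rewrite !inE; apply: contraNF rV => /eqP<-.
  exact: imset_f.
rewrite eqV => e; move: g_rank; rewrite -e; lia.
Qed.

(* With [y = 0] this bounds the arcs lost in a cut by [(k+1)^2/4], since a fibre
   split as [a + b] loses at most [a * b] of them. *)
Lemma same_fibre_pairs_bound S r0 y : y != 1 ->
    (#|fibre r0 :&: S| + y <= #|fibre r0 :\: S|) ||
    (#|fibre r0 :\: S| + y <= #|fibre r0 :&: S|) ->
  4 * #|same_fibre_pairs S| + y ^ 2 <= k.+1 ^ 2.
Proof.
move=> y1 hy.
have -> : y ^ 2 = \sum_r (r0 == r) * y ^ 2.
  by rewrite (bigD1 r0) //= eqxx mul1n big1 ?addn0 // => r /negPf; rewrite eq_sym => ->.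
rewrite card_same_fibre_pairs big_distrr -big_split /=.
apply: (@leq_trans (\sum_r cost #|fibre r|.-1)).
  apply: leq_sum => r _; rewrite -(cardsID S (fibre r)).
  case: eqVneq hy => [<-|_] hy; first by rewrite mul1n cost_split.
  by rewrite mul0n (@cost_split _ _ 0) // !addn0 leq_total.
apply: leq_trans (cost_sum _) _; have := sum_fibre.
by rewrite /cost; case: eqVneq => // _; rewrite leq_exp2r.
Qed.

End Lost.

(** * Cuts, and minimal violations of Hoffman's condition *)

Section Cuts.
Variable V : finType.
Implicit Types (A B : {set V * V}) (S : {set V}).

Lemma arc_strong_cut A n S x y : arc_strong n A -> x \in S -> y \notin S ->
  n <= #|arcs_between A S (~: S)|.
Proof.
move=> /forallP An xS yS; rewrite leqNgt; apply/negP=> lt.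
have /implyP := An (arcs_between A S (~: S)); rewrite lt andbT.
have -> : arcs_between A S (~: S) \subset A by apply/subsetP=> a; rewrite inE => /andP[].
move=> /(_ isT)/forallP/(_ x)/forallP/(_ y).
have -> : x != y by apply: contraNneq yS => <-.
move/(connect_enter (S := ~: S)); rewrite !inE xS yS => /(_ isT isT).
by case=> u [v]; rewrite !inE /= negbK => -[/andP[uvA uvB] uS vS]; rewrite uvB uS vS in uvA.
Qed.

Lemma strong_cuts B :
  (forall S x y, x \in S -> y \notin S -> 0 < #|arcs_between B S (~: S)|) -> strong B.
Proof.
move=> cuts; apply/forallP=> s; apply/forallP=> t; apply/implyP=> _.
pose S := [set z | connect (arc B) s z].
have [|tS] := boolP (t \in S); first by rewrite inE.
have sS : s \in S by rewrite inE.
have /card_gt0P[[u v]] := cuts S s t sS tS.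
rewrite !inE /= => /and3P[uv su /negP[]].
exact: connect_trans su (connect1 uv).
Qed.

(** Only violating pairs with [T :&: W] minimal need excluding. In these, out-neighbours of a vertex
    of [T :&: W] lie outside [W] and in-neighbours outside [T], so both differences are nonempty. *)
Lemma eulerian_factor B :
    loopless B -> strong B -> 1 < #|V| ->
    (forall T W : {set V}, T :|: W = setT ->
       (exists x, x \in T :\: W) -> (exists x, x \in W :\: T) ->
       (forall x y, x \in T :&: W -> y \in T :&: W -> (x, y) \notin B) ->
       #|T :&: W| <= #|arcs_between B T W|) ->
  exists H : {set V * V}, [/\ H \subset B, balanced H & forall x, 0 < outdeg H x].
Proof.
move=> loopB strB V2 noviol.
have out u : exists v, (u, v) \in B.
  have /card_gt0P[t] : 0 < #|[set~ u]| by rewrite cardsC1; lia.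
  rewrite !inE eq_sym => ut; have /implyP/(_ ut) := forallP (forallP strB u) t.
  case/(connect_enter (S := [set~ u]))=> [||w [v [wv]]]; rewrite !inE ?eqxx // eq_sym //.
  by rewrite negbK => /eqP->; exists v.
have inn u : exists v, (v, u) \in B.
  have /card_gt0P[t] : 0 < #|[set~ u]| by rewrite cardsC1; lia.
  rewrite !inE => tu; have /implyP/(_ tu) := forallP (forallP strB t) u.
  case/(connect_enter (S := [set u]))=> [||w [v [wv _]]]; rewrite !inE //.
  by move/eqP<-; exists w.
have [//|[T [W [TW lt]]]] := eulerian_factor_or_cut loopB; exfalso; move: lt.
have [n] := ubnP #|T :&: W|; elim: n T W TW => // n IHn T W TW leY lt.
have inTW z : (z \in T) || (z \in W) by rewrite -in_setU TW inE.
(* Given such an arc, removing [x] from [T] lowers [#|T :&: W|] by one and the arc count by at least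
   one: a smaller violation. *)
have noTW : forall x y, x \in T :&: W -> y \in W -> (x, y) \notin B.
  move=> x y xTW yW; apply/negP=> xyB; have /setIP[xT xW] := xTW.
  have eqY : (T :\ x) :&: W = (T :&: W) :\ x by rewrite setIDAC.
  have cY := cardsD1 x (T :&: W); rewrite xTW add1n in cY.
  have: #|arcs_between B (T :\ x) W| < #|arcs_between B T W|.
    apply/proper_card/properP; split.
      by apply/subsetP=> a; rewrite !inE => /and3P[-> /andP[_ ->] ->].
    by exists (x, y); rewrite !inE /= ?xyB ?xT ?yW ?eqxx.
  move=> lt'; apply: (IHn (T :\ x) W); rewrite ?eqY; try lia.
  apply/setP=> z; rewrite !inE; case: (eqVneq z x) => [->|_] //=; exact: inTW.
have noWT : forall x y, x \in T -> y \in T :&: W -> (x, y) \notin B.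
  move=> y x yT xTW; apply/negP=> xyB; have /setIP[xT xW] := xTW.
  have eqY : T :&: (W :\ x) = (T :&: W) :\ x by rewrite setIDA.
  have cY := cardsD1 x (T :&: W); rewrite xTW add1n in cY.
  have: #|arcs_between B T (W :\ x)| < #|arcs_between B T W|.
    apply/proper_card/properP; split.
      by apply/subsetP=> a; rewrite !inE => /and3P[-> -> /andP[_ ->]].
    by exists (y, x); rewrite !inE /= ?xyB ?yT ?xW ?eqxx ?andbF.
  move=> lt'; apply: (IHn T (W :\ x)); rewrite ?eqY; try lia.
  by apply/setP=> z; rewrite !inE; case: (eqVneq z x) => [->|_] //=; rewrite ?xT // inTW.
have /card_gt0P[u uTW] : 0 < #|T :&: W| by lia.
suff : #|T :&: W| <= #|arcs_between B T W| by rewrite leqNgt lt.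
apply: noviol => //.
- have [v uv] := out u; exists v; rewrite inE.
  have vW : v \notin W by apply: contraTN uv => vW; apply: noTW.
  by have := inTW v; rewrite (negPf vW) orbF.
- have [v vu] := inn u; exists v; rewrite inE.
  have vT : v \notin T by apply: contraTN vu => vT; apply: noWT.
  by have := inTW v; rewrite (negPf vT).
- by move=> x y xTW /setIP[_]; apply: noTW.
Qed.

End Cuts.

(** * From the arc-connectivity bound to the spanning eulerian subdigraph *)

Theorem theorem25 (k : nat) (V : finType) (A : {set V * V})
    (A_loopless : loopless A) (A_semicomplete : semicomplete A)
    (A_lambda : le_ext (k.+1%:R ^+ 2 / 4%:R + 1)%R (arc_connectivity A)) :
  forall A' : {set V * V}, A' \subset A -> #|A'| = k ->
  exists B : {set V * V},
    spanning_eulerian_subdigraph B A /\ [disjoint B & A'].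
Proof.
move=> A' A'A A'k; have [V1|V2] := leqP #|V| 1.
  exists set0; split; last by rewrite disjoint_sym; apply/pred0P=> a /=; rewrite inE andbF.
  rewrite /spanning_eulerian_subdigraph sub0set /=; apply/andP; split.
    apply/forallP=> s; apply/forallP=> t.
    by rewrite (fintype_le1P V1 s t).
  by apply/forallP=> x; rewrite /indeg /outdeg; apply/eqP/eq_card=> y; rewrite !inE.
have [n [nk An]] : exists n, k.+1 ^ 2 + 4 <= 4 * n /\ arc_strong n A.
  move: A_lambda; case E: (arc_connectivity A) => [n|] /= H; last first.
    by move: E; rewrite /arc_connectivity V2.
  exists n; split; last by rewrite arc_strongE E /=.
  have : (k.+1%:R ^+ 2 + 4%:R <= 4%:R * n%:R :> rat)%R by lra.
  by rewrite -natrX -natrD -natrM ler_nat.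
have [g [gA' g_rank]] := exists_fibration A'; rewrite A'k in g_rank.
pose B := [set a in A | g a.1 != g a.2].
have BA : B \subset A by apply/subsetP=> a; rewrite inE => /andP[].
have cutB S : #|arcs_between A S (~: S)| <=
    #|arcs_between B S (~: S)| + #|same_fibre_pairs g S|.
  apply: leq_trans (leq_card_setU _ _); apply/subset_leq_card/subsetP=> a.
  by rewrite !inE => /and3P[-> -> ->]; case: eqP.
have cut (S : {set V}) x y : x \in S -> y \notin S -> n <=
    #|arcs_between B S (~: S)| + #|same_fibre_pairs g S|.
  by move=> xS yS; apply: leq_trans (cutB S); apply: arc_strong_cut An xS yS.
(* With [y = 0], four times the loss is at most [k.+1 ^ 2], hence at most [4 * n - 4]: every cut
   keeps an arc. *)
have strB : strong B.
  apply: strong_cuts => S x y xS yS; have := cut S x y xS yS.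
  have := @same_fibre_pairs_bound _ _ _ g_rank S x 0 isT.
  by rewrite !addn0 leq_total => /(_ isT); lia.
have adjB x y : g x != g y -> ((x, y) \in B) || ((y, x) \in B).
  move=> gxy; have xy : x != y by apply: contraNneq gxy => ->.
  have /implyP/(_ xy) := forallP (forallP A_semicomplete x) y.
  by rewrite !inE /= gxy eq_sym gxy !andbT.
have looplessB : loopless B.
  by apply/forallP=> x; apply: contra (forallP A_loopless x); apply: (subsetP BA).
have factB : exists H : {set V * V}, [/\ H \subset B, balanced H & forall x, 0 < outdeg H x].
  apply: eulerian_factor => // T W TW [x xT] [z zW] indep.
  rewrite leqNgt; apply/negP=> lt.
  have /card_gt0P[u uTW] : 0 < #|T :&: W| by lia.
  move: lt; set q := #|T :&: W| => lt; pose P := fibre g (g u).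
  have PY : T :&: W \subset P.
    apply/subsetP=> v vTW; rewrite inE; apply: contraT => /adjB.
    by rewrite (negPf (indep _ _ vTW uTW)) (negPf (indep _ _ uTW vTW)).
  have inTW v : (v \in T) || (v \in W) by rewrite -in_setU TW inE.
  have arcs_le (S : {set V}) : S \subset T -> ~: S \subset W ->
      #|arcs_between B S (~: S)| <= #|arcs_between B T W|.
    move=> /subsetP ST /subsetP SW; apply/subset_leq_card/subsetP=> a.
    by rewrite !inE => /and3P[-> /ST-> aS] /=; apply: SW; rewrite inE.
  (* The surplus 1 is barred from [same_fibre_pairs_bound], so 0 replaces it; [4 * q <= 4 + q' ^ 2]
     survives, by [(q - 2)^2 >= 0] when [q] is not 1. *)
  pose q' := if q == 1 then 0 else q.
  have q'1 : q' != 1 by rewrite /q'; case: (eqVneq q 1).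
  have q'q : q' <= q by rewrite /q'; case: (eqVneq q 1).
  have qq' : 4 * q <= 4 + q' ^ 2.
    rewrite /q' -mulnn; case: (eqVneq q 1) => [->|_] //.
    by case: (q) => [|[|m]] //; clear; nia.
  (* A cut splitting [P] with surplus [q] keeps at least [(4 + q' ^ 2) / 4], hence [q], arcs, all
     from [T] to [W]. *)
  have finish (S : {set V}) : S \subset T -> ~: S \subset W -> x \in S -> z \notin S ->
      (#|P :&: S| + q <= #|P :\: S|) || (#|P :\: S| + q <= #|P :&: S|) -> False.
    move=> ST SW xS zS bal; have := arcs_le S ST SW; have := cut S x z xS zS.
    have bal' : (#|P :&: S| + q' <= #|P :\: S|) || (#|P :\: S| + q' <= #|P :&: S|).
      by case/orP: bal => bal; apply/orP; [left|right]; apply: leq_trans bal;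
        rewrite leq_add2l.
    have := same_fibre_pairs_bound g_rank q'1 bal'.
    move: nk qq' lt; move: (k.+1 ^ 2) (q' ^ 2) => K Q; clear; lia.
  move: xT zW; rewrite !inE => /andP[xW xT] /andP[zT zW].
  have sTW v : v \notin T -> v \in W by move=> /negPf vT; have := inTW v; rewrite vT.
  have sWT v : v \notin W -> v \in T by move=> /negPf vW; have := inTW v; rewrite vW orbF.
  have CT : ~: T \subset W by apply/subsetP=> v; rewrite inE; apply: sTW.
  have CW : ~: W \subset T by apply/subsetP=> v; rewrite inE; apply: sWT.
  (* [P] has [a + q + b] vertices. The cut [T] splits it as [b + q] against [a], the cut [~: W] as
     [b] against [a + q]; the larger of [a] and [b] decides which has surplus [q]. *)
  pose a := #|P :&: ~: T|; pose b := #|P :&: ~: W|.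
  have PT : #|P :&: T| = b + q.
    rewrite -(cardsID W (P :&: T)) addnC; congr (_ + _).
      apply: eq_card => v; rewrite !inE.
      by case: (boolP (v \in W)) => [|/sWT->] //=; rewrite ?andbF ?andbT.
    rewrite -setIA; congr #|pred_of_set _|; exact/setIidPr.
  have PW : #|P :&: W| = a + q.
    rewrite -(cardsID T (P :&: W)) addnC; congr (_ + _).
      apply: eq_card => v; rewrite !inE.
      by case: (boolP (v \in T)) => [|/sTW->] //=; rewrite ?andbF ?andbT.
    rewrite -setIA [W :&: T]setIC; congr #|pred_of_set _|; exact/setIidPr.
  have [ab|ba] := leqP a b.
    by apply: (finish T); rewrite // setDE PT -/a leq_add2r ab orbT.
  apply: (finish (~: W)); rewrite ?setCK ?inE ?negbK //.
  by rewrite setDE setCK PW -/b leq_add2r (ltnW ba).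
have [|H /andP[HB eH]] := connected_factor strB _ factB.
  move=> u v x uv xu xv; rewrite orbA; have [gxu|/adjB->//] := eqVneq (g x) (g u).
  have /adjB -> : g x != g v by move: uv; rewrite inE /= gxu => /andP[].
  by rewrite orbT.
exists H; split; first by rewrite /spanning_eulerian_subdigraph (subset_trans HB BA).
apply/pred0P=> a /=; apply/andP=> -[/(subsetP HB)]; rewrite inE => /andP[_ /eqP].
by move=> ga /gA'.
Qed.
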